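(* Let $\mathcal{D}$ be a Menon $2$-design with parameters $(64,28,12)$ (such a design exists), let $\Gamma(\mathcal{D})$ be its incidence graph, and let $\mathcal{B}_{128}$ be the set of all connected bipartite graphs of order $128$ (up to isomorphism). Then $$\mathrm{secc}_{\mathcal{B}_{128}}\left(K_{64,64}\right)=\sigma\left(K_{64,64},\Gamma(\mathcal{D})\right)<\sigma(\Gamma(\mathcal{D}),B_{128,43}),$$ and consequently $\mathrm{sdiam}(\mathcal{B}_{128})\neq \mathrm{secc}_{\mathcal{B}_{128}}(K_{64,64})$; that is, the conjectured equality $\mathrm{sdiam}(\mathcal{B}_n)=\mathrm{secc}_{\mathcal{B}_n}(K_{\lceil n/2\rceil,\lfloor n/2\rfloor})$ fails for $n=128$.
   Context: All graphs are finite, simple and undirected. For a graph $G$ on $n$ vertices, $\lambda_1(G)\geq\cdots\geq\lambda_n(G)$ denote the eigenvalues of its adjacency matrix, with multiplicity, in non-increasing order. The spectral distance between two graphs $G,H$ on $n$ vertices is $\sigma(G,H)=\sum_{i=1}^{n}|\lambda_i(G)-\lambda_i(H)|$. For a set $\mathcal{G}$ of pairwise non-isomorphic graphs of order $n$ and $G\in\mathcal{G}$, the spectral eccentricity is $\mathrm{secc}_{\mathcal{G}}(G)=\max\{\sigma(G,H):H\in\mathcal{G},\,H\not\cong G\}$ and the spectral diameter is $\mathrm{sdiam}(\mathcal{G})=\max\{\mathrm{secc}_{\mathcal{G}}(G):G\in\mathcal{G}\}$. $\mathcal{B}_n$ is the set of all connected bipartite graphs of order $n$ (up to isomorphism). $K_{p,q}$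 is the complete bipartite graph with parts of sizes $p$ and $q$. A Menon $2$-design with parameters $(64,28,12)$ is a symmetric design: 64 points and 64 blocks (subsets of the point set) such that every block contains exactly 28 points, every point lies in exactly 28 blocks, and any two distinct points lie together in exactly 12 blocks. The incidence graph $\Gamma(\mathcal{D})$ is the bipartite graph whose vertices are the points and the blocks, a point and a block being adjacent if and only if the point belongs to the block (and no other adjacencies). For even $n$ and an integer $1\leq p<\frac{n}{2}$, $B_{n,p}$ is the connected bipartite graph of order $n$ with bipartition $X=\{x_1,\ldots,x_{n/2}\}$, $Y=\{y_1,\ldots,y_{n/2}\}$, in which $x_i$ with $i\leq p$ is adjacent to all of $y_1,\ldots,y_{n/2}$, and $x_i$ with $i>p$ is adjacent exactly to $y_1,\ldots,y_p$. *)

(* Defs.v *)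
From HB Require Import structures.
From mathcomp Require Import all_boot all_order all_algebra.
From mathcomp Require Import polyrcf.

Set Implicit Arguments.
Unset Strict Implicit.
Unset Printing Implicit Defensive.

Import Order.TTheory GRing.Theory Num.Theory.

Local Open Scope ring_scope.

Definition simple_graph_axiom (V : finType) (e : {ffun V * V -> bool}) : bool :=
  [forall x, ~~ e (x, x)] && [forall x, forall y, e (x, y) == e (y, x)].

(* Edges are a finite function (not a [rel V]) so that [sgraph V] is a finType. *)
Record sgraph (V : finType) := SGraph {
  edge_fun : {ffun V * V -> bool};
  edge_funP : simple_graph_axiom edge_fun
}.

HB.instance Definition _ (V : finType) := [isSub of sgraph V for @edge_fun V].
HB.instance Definition _ (V : finType) := [Equality of sgraph V by <:].
HB.instance Definition _ (V : finType) := [Choice of sgraph V by <:].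
HB.instance Definition _ (V : finType) := [Countable of sgraph V by <:].
HB.instance Definition _ (V : finType) := [Finite of sgraph V by <:].

Definition adj (V : finType) (G : sgraph V) : rel V := fun x y => edge_fun G (x, y).

Definition graph_iso (V W : finType) (G : sgraph V) (H : sgraph W) : bool :=
  (#|V| == #|W|) &&
  [exists f : {ffun V -> W},
     injectiveb f && [forall x, forall y, adj G x y == adj H (f x) (f y)]].

Definition connected_graph (V : finType) (G : sgraph V) : bool :=
  [forall x, forall y, connect (adj G) x y].

Definition bipartite_graph (V : finType) (G : sgraph V) : bool :=
  [exists X : {set V},
     [forall x, forall y, adj G x y ==> ((x \in X) != (y \in X))]].

Definition bip_edge (P Q : finType) (r : P -> Q -> bool) :
    {ffun (P + Q) * (P + Q) -> bool} :=
  [ffun uv => match uv with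
              | (inl p, inr q) => r p q
              | (inr q, inl p) => r p q
              | _ => false
              end].

Lemma bip_edgeP (P Q : finType) (r : P -> Q -> bool) :
  simple_graph_axiom (bip_edge r).
Proof.
apply/andP; split; first by apply/forallP => -[p|q]; rewrite ffunE.
by apply/forallP => -[p|q]; apply/forallP => -[p'|q']; rewrite !ffunE.
Qed.

Definition bip_graph (P Q : finType) (r : P -> Q -> bool) : sgraph (P + Q)%type :=
  SGraph (bip_edgeP r).

Definition complete_bipartite (p q : nat) : sgraph ('I_p + 'I_q)%type :=
  bip_graph (fun (_ : 'I_p) (_ : 'I_q) => true).

(* Meant for even [n] and [1 <= p < n/2].  The vertices x_i, y_j are indexed
   from 0, so that "i <= p" for indices starting at 1 becomes [i < p]. *)
Definition Bgraph (n p : nat) : sgraph ('I_n./2 + 'I_n./2)%type :=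
  bip_graph (fun i j : 'I_n./2 => (i < p)%N || (j < p)%N).

Definition symmetric_design (v k l : nat) (P : finType) (D : {set {set P}}) : Prop :=
  [/\ #|P| = v,
      #|D| = v,
      forall B, B \in D -> #|B| = k,
      forall x : P, #|[set B in D | x \in B]| = k
    & forall x y : P, x != y -> #|[set B in D | (x \in B) && (y \in B)]| = l].

Definition incidence_graph (P : finType) (D : {set {set P}}) :
    sgraph (P + {B : {set P} | B \in D})%type :=
  bip_graph (fun (x : P) (B : {B : {set P} | B \in D}) => x \in val B).

Section Spectral.
Variable R : rcfType.

Definition adjmx (V : finType) (G : sgraph V) : 'M[R]_#|V| :=
  \matrix_(i, j) (adj G (enum_val i) (enum_val j))%:R.

(* The eigenvalues lying in [R], in nonincreasing order ([rootsR] lists the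
   distinct roots in increasing order), with algebraic multiplicity; there are
   [m] of them when [A] is symmetric. *)
Definition eigenvalues (m : nat) (A : 'M[R]_m) : seq R :=
  flatten [seq nseq (mup x (char_poly A)) x | x <- rev (rootsR (char_poly A))].

(* Counted from 0: the largest eigenvalue is [lambda G 0]. *)
Definition lambda (V : finType) (G : sgraph V) (i : nat) : R :=
  (eigenvalues (adjmx G))`_i.

(* The vertex types may differ; only meaningful when [#|V| = #|W|]. *)
Definition sigma (V W : finType) (G : sgraph V) (H : sgraph W) : R :=
  \sum_(i < #|V|) `|lambda G i - lambda H i|.

(* A set of graphs of order [n] up to isomorphism is represented by the set of
   all labelled graphs on ['I_n] in its isomorphism classes; since [sigma] only
   depends on isomorphism classes, the maxima below are unaffected.  [sigma] is
   nonnegative, so the base value 0 only matters for a maximum over the empty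
   set.  [G] may live on any vertex type of cardinal [n], and is meant to be
   isomorphic to a member of [F]. *)
Definition secc (n : nat) (F : {set sgraph 'I_n}) (V : finType) (G : sgraph V) : R :=
  \big[Num.max/0]_(H in F | ~~ graph_iso H G) sigma G H.

Definition sdiam (n : nat) (F : {set sgraph 'I_n}) : R :=
  \big[Num.max/0]_(G in F) secc F G.

End Spectral.

Definition conn_bipartite (n : nat) : {set sgraph 'I_n} :=
  [set G | connected_graph G && bipartite_graph G].

Definition sdiam_conjecture (R : rcfType) (n : nat) : Prop :=
  sdiam R (conn_bipartite n) =
  secc R (conn_bipartite n) (complete_bipartite (uphalf n) n./2).

(* Main.v *)
Require Import Defs.
From mathcomp Require Import all_boot all_order all_algebra.
From mathcomp Require Import perm complex polyrcf zify ring lra.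
Import Order.TTheory GRing.Theory Num.Theory.
Local Open Scope ring_scope.

(** Write [K] for the complete bipartite graph with parts of size 64, whose
    spectrum is 64, 0 (126 times), -64.

    Upper bound.  Let [H] be bipartite on 128 vertices, with [e] the sum of the
    entries of its adjacency matrix, so that the squares of the eigenvalues add
    up to [e].  Testing the quadratic form on the all-ones vector and on the
    [+1/-1] vector of the bipartition gives [l_1 >= e/128] and
    [l_128 <= -e/128].  Each of the 126 middle eigenvalues satisfies
    [|x| <= x^2/8 + 2], the tangent-line form of Cauchy-Schwarz with equality
    at [|x| = 4].  After summation the two ends decouple: each of
    [a = l_1] and [a = -l_128] contributes at most [64 + 7a - a^2/8] if
    [a <= 64], and at most 98 otherwise.  The parabola peaks at [a = 28] with
    value 162, so
    [sigma(K,H) <= 252 + 2 * 162 = 576] ([sigma_le_576]).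

    Equality.  For a (64,28,12) design with incidence matrix [N] one has
    [N N^T = 16 I + 12 J], so the eigenvalues of the incidence graph square to
    16 or 784 ([spectrum_design]); [28] and [-28] occur, and the sum of squares
    forces the 126 others to have absolute value 4.  Hence
    [sigma(K,Gamma) = 576].

    The third graph.  [B_{128,43}] has exactly four nonzero eigenvalues
    [+-b1], [+-b2], with [b1 = (s+43)/2], [b2 = (s-43)/2], [s^2 = 5461]
    ([spectrum_B]).  Against the spectrum of [Gamma] this gives at least
    [2 (b1 - 28) + 2 (b2 - 4) + 4 * 124 = 2 s + 432], which exceeds 576 because
    [s > 72] ([sigma_design_B]).

    Spectra are never computed from a characteristic polynomial: once enough
    distinct eigenvalues are exhibited, the trace of the squared adjacency
    matrix determines the remaining ones ([spectrum_extend]).  The design comes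
    from words of length 3 over a 4-letter alphabet ([menon_design]). *)

(** * Spectra of real symmetric matrices *)

(** A split characteristic polynomial determines [eigenvalues]: that list is
    sorted, and multiplicities are read off the factorisation. *)
Lemma eigenvaluesE (R : rcfType) (m : nat) (A : 'M[R]_m) (s t : seq R) :
  char_poly A = \prod_(x <- t) ('X - x%:P) -> perm_eq s t ->
  sorted >=%R s -> eigenvalues A = s.
Proof.
move=> charA st s_sorted.
have A0 : char_poly A != 0 by rewrite monic_neq0 ?char_poly_monic.
have rootA x : (x \in rootsR (char_poly A)) = (x \in t).
  by rewrite -roots_on_rootsR // charA root_prod_XsubC.
have uroots : uniq (rootsR (char_poly A)).
  by apply: (@sorted_uniq _ <%R); [exact: lt_trans | exact: ltxx | exact: sorted_roots].
apply: (sorted_eq ge_trans ge_anti) => //.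
  have : sorted >%R (rev (rootsR (char_poly A))) by rewrite rev_sorted sorted_roots.
  rewrite /eigenvalues; elim: (rev _) => //= x r IHr path_r.
  have {}IHr := IHr (path_sorted path_r).
  have lt_r : all (fun y => y < x) r by apply: (order_path_min _ path_r); exact/rev_trans/lt_trans.
  elim: (mup _ _) => //= k IHk; rewrite path_min_sorted //.
  apply/allP => y; rewrite mem_cat => /orP[/nseqP[-> _]|]; first exact: lexx.
  by case/flatten_mapP => z zr /nseqP[-> _]; exact/ltW/(allP lt_r).
rewrite perm_sym; apply: perm_trans st _; rewrite perm_sym.
apply/allP => x _ /=; apply/eqP.
rewrite /eigenvalues count_flatten -map_comp.
rewrite (eq_map (g := fun y => (y == x) * count_mem x t)%N); last first.
  move=> y /=; rewrite count_nseq /=.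
  by case: eqVneq => [->|_]; rewrite ?mul0n // !mul1n charA mu_prod_XsubC.
rewrite [RHS](_ : _ = ((x \in rev (rootsR (char_poly A))) * count_mem x t)%N); last first.
  by rewrite mem_rev rootA; case: (boolP (x \in t)) => [_|/count_memPn ->]; rewrite ?mul1n.
rewrite -rev_uniq in uroots; elim: (rev _) uroots => //= y r IHr /andP[yr /IHr ur].
rewrite in_cons ur eq_sym; case: eqVneq yr => [-> /negPf->|_ _] //; rewrite ?mul1n ?mul0n ?addn0 //.
Qed.

Lemma char_poly_conj (F : fieldType) (m : nat) (P A : 'M[F]_m) :
  P \in unitmx -> char_poly (invmx P *m A *m P) = char_poly A.
Proof.
move=> uP; pose C := map_mx (@polyC F).
have -> : char_poly (invmx P *m A *m P) =
    \det (C _ _ (invmx P) *m char_poly_mx A *m C _ _ P).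
  rewrite /char_poly /char_poly_mx mulmxBr mulmxBl mul_mx_scalar -scalemxAl.
  by rewrite /C -!map_mxM mulVmx // map_mx1 scalemx1.
rewrite !det_mulmx mulrAC -det_mulmx /C -map_mxM mulVmx //.
by rewrite map_mx1 det1 mul1r.
Qed.

Local Open Scope sesquilinear_scope.

(** The complex spectral theorem, read over the reals: the matrix becomes
    Hermitian over [R[i]], so it is unitarily diagonalisable with real
    eigenvalues [d].  The weights [w] attached to a vector [v] are the squared
    moduli of its coordinates in the eigenbasis, and express the squared norm
    and the quadratic form of [v] simultaneously. *)
Lemma spectral_data (R : rcfType) (m : nat) (A : 'M[R]_m) : A^T = A ->
  exists d : 'I_m -> R,
    [/\ char_poly A = \prod_(i < m) ('X - (d i)%:P),
        \tr (A *m A) = \sum_(i < m) d i ^+ 2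
      & forall v : 'rV[R]_m, exists w : 'I_m -> R,
        [/\ forall i, 0 <= w i,
            \sum_(i < m) w i = (v *m v^T) 0 0
          & \sum_(i < m) w i * d i = (v *m A *m v^T) 0 0]].
Proof.
move=> symA; pose f : {rmorphism R -> R[i]} := real_complex R; pose B := map_mx f A.
have Bherm : B \is hermsymmx.
  apply: realsym_hermsym.
    apply/is_hermitianmxP; rewrite expr0 scale1r map_mx_id //.
    by rewrite /B map_trmx symA.
  by apply/mxOverP => i j; rewrite mxE complex_real.
have := hermitian_spectral_diag_real Bherm.
have /orthomx_spectralP := hermitian_normalmx Bherm.
move: (spectral_unitarymx B) (spectral_unit B).
move: (spectralmx B) (spectral_diag B) => P sp Pu Pun eqB /mxOverP dreal.
pose d i : R := complex.Re (sp 0 i).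
have dE i : f (d i) = sp 0 i by exact: RRe_real.
have f_inj : injective f by exact: complexI.
exists d; split.
- apply: (map_poly_inj f).
  rewrite map_char_poly -/B eqB char_poly_conj // char_poly_trig ?diag_mx_is_trig //.
  rewrite rmorph_prod; apply: eq_bigr => i _.
  by rewrite mxE eqxx mulr1n -dE rmorphB /= map_polyX map_polyC.
- apply: f_inj; rewrite -trace_map_mx map_mxM -/B eqB !mulmxA mulmxK //.
  rewrite mxtrace_mulC !mulmxA mulmxV // mul1mx mulmx_diag mxtrace_diag rmorph_sum.
  by apply: eq_bigr => i _; rewrite mxE -!dE -rmorphM -expr2.
- move=> v; pose v' := map_mx f v; pose u := v' *m invmx P.
  have absE i : f (complex.Re (`|u 0 i| ^+ 2)) = u 0 i * (u 0 i)^*.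
    by rewrite -normCK; apply: RRe_real; rewrite rpredX ?normr_real.
  have v'C : v' ^t* = map_mx f v^T.
    by apply/matrixP => i j; rewrite !mxE; apply: conjc_real.
  have uC : u ^t* = P *m v' ^t*.
    by rewrite /u invmx_unitary // trmx_mul map_mxM trmxCK.
  exists (fun i => complex.Re (`|u 0 i| ^+ 2)); split.
  + by move=> i; rewrite -ler0c [X in 0 <= X]absE -normCK exprn_ge0.
  + apply: f_inj; rewrite rmorph_sum (eq_bigr _ (fun i _ => absE i)).
    transitivity ((u *m u ^t* ) 0 0); first by rewrite mxE; apply: eq_bigr => i _; rewrite !mxE.
    by rewrite uC /u mulmxA mulmxKV // v'C -map_mxM mxE.
  + apply: f_inj; rewrite rmorph_sum.
    transitivity ((u *m diag_mx sp *m u ^t* ) 0 0).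
      rewrite mul_mx_diag mxE; apply: eq_bigr => i _.
      by rewrite rmorphM /= absE dE !mxE mulrAC.
    rewrite uC /u -!mulmxA [X in v' *m X]mulmxA [invmx P *m _ *m _]mulmxA -eqB.
    by rewrite v'C /v' /B -!map_mxM [LHS]mxE mulmxA.
Qed.

Lemma symmetric_spectrum (R : rcfType) (m : nat) (A : 'M[R]_m) : A^T = A ->
  [/\ char_poly A = \prod_(x <- eigenvalues A) ('X - x%:P),
      size (eigenvalues A) = m, sorted >=%R (eigenvalues A)
    & \sum_(x <- eigenvalues A) x ^+ 2 = \tr (A *m A)].
Proof.
case/spectral_data => d [charA trA _].
have permA : perm_eq (sort >=%R (codom d)) (codom d) by apply/permPl/perm_sort.
have sortA : sorted >=%R (sort >=%R (codom d)) by apply: sort_sorted; exact: ge_total.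
have charA' : char_poly A = \prod_(x <- codom d) ('X - x%:P).
  by rewrite charA /codom /image_mem big_map big_enum.
rewrite (eigenvaluesE _ _ _ _ _ charA' permA sortA) (perm_big _ permA) (perm_big _ permA).
split=> //; first by rewrite size_sort size_codom card_ord.
by rewrite trA /codom /image_mem big_map big_enum.
Qed.

(** The quadratic form is an average of the eigenvalues with the weights of
    [spectral_data], hence lies between the extreme ones. *)
Lemma rayleigh (R : rcfType) (m : nat) (A : 'M[R]_m) (v : 'rV[R]_m) : A^T = A ->
  last 0 (eigenvalues A) * (v *m v^T) 0 0 <= (v *m A *m v^T) 0 0
    <= head 0 (eigenvalues A) * (v *m v^T) 0 0.
Proof.
move=> symA; have [charA szA sortA _] := symmetric_spectrum _ _ _ symA.
have [d [chard _ /(_ v)[w [w_ge0 <- <-]]]] := spectral_data _ _ _ symA.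
have d_mem i : d i \in eigenvalues A.
  by rewrite -root_prod_XsubC -charA chard (bigD1 i) //= rootM root_XsubC eqxx.
have nth_ge := sorted_leq_nth ge_trans ge_refl 0 sortA.
have d_nth i : exists2 k, (k < size (eigenvalues A))%N & d i = (eigenvalues A)`_k.
  by exists (index (d i) (eigenvalues A)); rewrite ?index_mem ?nth_index.
rewrite !mulr_sumr -nth_last -nth0; apply/andP; split; apply: ler_sum => i _.
  rewrite mulrC ler_wpM2l //; have [k ltk ->] := d_nth i.
  have s_gt0 : (0 < size (eigenvalues A))%N by exact: leq_ltn_trans ltk.
  by apply: nth_ge; rewrite ?inE ?ltn_predL // -ltnS prednK.
rewrite mulrC ler_wpM2r //; have [k ltk ->] := d_nth i.
by apply: nth_ge; rewrite ?inE //; exact: leq_ltn_trans ltk.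
Qed.

(** * Spectra of graphs *)

Lemma adj_sym (V : finType) (G : sgraph V) (x y : V) : adj G x y = adj G y x.
Proof. by have /andP[_ /forallP/(_ x)/forallP/(_ y)/eqP] := edge_funP G. Qed.

Lemma tr_adjmx (R : rcfType) (V : finType) (G : sgraph V) :
  (adjmx R G)^T = adjmx R G.
Proof. by apply/matrixP => i j; rewrite !mxE adj_sym. Qed.

Lemma sum_enum_val (R : rcfType) (V : finType) (F : V -> R) :
  \sum_(i < #|V|) F (enum_val i) = \sum_x F x.
Proof. by rewrite (reindex _ (onW_bij _ (enum_val_bij V))). Qed.

Lemma graph_spectrum (R : rcfType) (V : finType) (G : sgraph V) :
  let s := eigenvalues (adjmx R G) in
  [/\ size s = #|V|, sorted >=%R s
    & \sum_(x <- s) x ^+ 2 = \sum_x \sum_y (adj G x y)%:R].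
Proof.
move=> s; have [_ szs sorts sqs] := symmetric_spectrum _ _ _ (tr_adjmx R V G).
split=> //; rewrite sqs.
rewrite -[RHS]sum_enum_val; apply: eq_bigr => i _; rewrite mxE -[RHS]sum_enum_val.
by apply: eq_bigr => j _; rewrite !mxE adj_sym -natrM mulnb andbb.
Qed.

Lemma graph_rayleigh (R : rcfType) (V : finType) (G : sgraph V) (F : V -> R) :
  let s := eigenvalues (adjmx R G) in
  last 0 s * (\sum_x F x ^+ 2)
    <= \sum_x \sum_y F x * F y * (adj G x y)%:R <= head 0 s * (\sum_x F x ^+ 2).
Proof.
rewrite /=; pose v : 'rV[R]_#|V| := \row_i F (enum_val i).
have := rayleigh R _ (adjmx R G) v (tr_adjmx R V G).
have -> : (v *m v^T) 0 0 = \sum_x F x ^+ 2.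
  by rewrite -[RHS]sum_enum_val mxE; apply: eq_bigr => i _; rewrite !mxE expr2.
suff -> : (v *m adjmx R G *m v^T) 0 0 = \sum_x \sum_y F x * F y * (adj G x y)%:R by [].
rewrite exchange_big -[RHS]sum_enum_val mxE; apply: eq_bigr => j _ /=.
rewrite -[RHS]sum_enum_val !mxE mulr_suml.
by apply: eq_bigr => i _; rewrite !mxE mulrAC.
Qed.

(** Eigenvectors as functions on the vertices, free of any enumeration. *)
Lemma graph_eigenvalueP (R : rcfType) (V : finType) (G : sgraph V) (a : R) :
  a \in eigenvalues (adjmx R G) <->
  exists2 F : V -> R, (exists x, F x != 0)
    & forall y, \sum_x F x * (adj G x y)%:R = a * F y.
Proof.
have [charA _ _ _] := symmetric_spectrum _ _ _ (tr_adjmx R V G).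
rewrite -root_prod_XsubC -charA -eigenvalue_root_char.
split=> [/eigenvalueP[v vA v0] | [F [x Fx0] FA]].
  exists (fun x => v 0 (enum_rank x)).
    have /rV0Pn[i vi] := v0; exists (enum_val i); by rewrite enum_valK.
  move=> y; have /rowP/(_ (enum_rank y)) := vA; rewrite !mxE => <-.
  by rewrite -[LHS]sum_enum_val; apply: eq_bigr => i _; rewrite !mxE enum_valK enum_rankK.
apply/eigenvalueP; exists (\row_i F (enum_val i)).
  apply/rowP => j; rewrite !mxE -FA -[RHS]sum_enum_val.
  by apply: eq_bigr => i _; rewrite !mxE.
by apply/rV0Pn; exists (enum_rank x); rewrite mxE enum_rankK.
Qed.

Lemma perm_extend (T : eqType) (a s : seq T) :
  uniq a -> {subset a <= s} -> exists t, perm_eq s (a ++ t).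
Proof.
elim: a => [|x a IHa] /=; first by exists s.
case/andP => xa ua sub_s.
have [y ya|t st] := IHa ua; first by apply: sub_s; rewrite in_cons ya orbT.
have xt : x \in t.
  by have := sub_s x (mem_head _ _); rewrite (perm_mem st) mem_cat (negPf xa).
exists (rem x t); apply: perm_trans st _; rewrite -cat1s perm_sym perm_catCA perm_cat2l.
by rewrite perm_sym; exact: perm_to_rem.
Qed.

(** Suppose that [a] lists distinct eigenvalues, that all eigenvalues have
    square at least [c], and that the sum of all squares is what it would be if
    the eigenvalues outside [a] had square exactly [c].  Then they do, since the
    excesses [x^2 - c] are nonnegative and add up to 0. *)
Lemma spectrum_extend (R : rcfType) (V : finType) (G : sgraph V) (a : seq R) (c : R) :
  let s := eigenvalues (adjmx R G) in
  uniq a -> {subset a <= s} -> {in s, forall x, c <= x ^+ 2} ->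
  \sum_(x <- a) x ^+ 2 + c * (#|V| - size a)%:R = \sum_x \sum_y (adj G x y)%:R ->
  exists2 t, perm_eq s (a ++ t) & {in t, forall x, x ^+ 2 = c}.
Proof.
move=> s ua sub_s s_ge sum_a; have [szs _ sqs] := graph_spectrum R V G.
have [t st] := perm_extend _ _ _ ua sub_s.
exists t => // x xt.
have szt : (#|V| - size a)%N = size t by rewrite -szs (perm_size st) size_cat addKn.
have t_ge y : y \in t -> 0 <= y ^+ 2 - c.
  by move=> yt; rewrite subr_ge0 s_ge // (perm_mem st) mem_cat yt orbT.
have : \sum_(y <- t) (y ^+ 2 - c) = 0.
  apply/eqP; rewrite sumrB big_const_seq count_predT iter_addr_0 -mulr_natr -szt subr_eq0.
  by rewrite -(inj_eq (addrI (\sum_(y <- a) y ^+ 2))) sum_a -sqs (perm_big _ st) big_cat.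
rewrite big_seq => /eqP; rewrite psumr_eq0 // => /allP/(_ _ xt).
by rewrite xt subr_eq0 => /eqP.
Qed.

(** The two extreme terms of the spectral distance are isolated because they
    are the ones controlled by Rayleigh quotients. *)
Lemma sigmaE (R : rcfType) (V W : finType) (G : sgraph V) (H : sgraph W) (a b c d : R)
    (s t : seq R) :
  eigenvalues (adjmx R G) = a :: rcons s b -> eigenvalues (adjmx R H) = c :: rcons t d ->
  size s = size t ->
  sigma R G H = `|a - c| + \sum_(p <- zip s t) `|p.1 - p.2| + `|b - d|.
Proof.
move=> sG sH eqsz; have [szG _ _] := graph_spectrum R V G.
have -> : sigma R G H = \sum_(p <- zip (a :: rcons s b) (c :: rcons t d)) `|p.1 - p.2|.
  rewrite (big_nth (0, 0)) size1_zip; last by rewrite /= !size_rcons eqsz.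
  rewrite -sG szG big_mkord; apply: eq_bigr => i _.
  by rewrite /lambda sH nth_zip // -sH sG sH /= !size_rcons eqsz.
by rewrite /= zip_rcons // -cats1 big_cons big_cat big_seq1 /= addrA.
Qed.

Lemma seq_ends (T : Type) (s : seq T) (k : nat) : size s = k.+2 ->
  exists a b t, s = a :: rcons t b /\ size t = k.
Proof.
case: s => [//|a s] /= [sz]; case/lastP: s sz => [//|t b].
by rewrite size_rcons => -[sz]; exists a, b, t.
Qed.

Lemma sorted_ends (R : rcfType) (a b : R) (t : seq R) : sorted >=%R t ->
  b <= a -> {in t, forall x, b <= x <= a} -> sorted >=%R (a :: rcons t b).
Proof.
move=> st ba bt; rewrite /= rcons_path.
have -> : path >=%R a t.
  by rewrite path_min_sorted //; apply/allP => x /bt/andP[].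
case/lastP: t st bt => [//|t y] _ bt; rewrite last_rcons.
have y_in : y \in rcons t y by rewrite mem_rcons mem_head.
by have /andP[] := bt y y_in.
Qed.

(** The case [c = 0] of [spectrum_extend], where nonnegativity of squares is the
    only lower bound required. *)
Lemma spectrum_extend0 (R : rcfType) (V : finType) (G : sgraph V) (a : seq R) :
  let s := eigenvalues (adjmx R G) in
  uniq a -> {subset a <= s} ->
  \sum_(x <- a) x ^+ 2 = \sum_x \sum_y (adj G x y)%:R ->
  perm_eq s (a ++ nseq (#|V| - size a) 0).
Proof.
move=> s ua sub_s sum_a; have [szs _ _] := graph_spectrum R V G.
have [||t perm_t t0] := spectrum_extend R V G a 0 ua sub_s.
- by move=> x _; rewrite sqr_ge0.
- by rewrite mul0r addr0.
rewrite (_ : nseq _ 0 = t) //; apply/esym; rewrite -szs (perm_size perm_t) size_cat addKn.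
by apply/all_pred1P/allP => x /t0/eqP; rewrite sqrf_eq0.
Qed.

Lemma spectrum_ends (R : rcfType) (V : finType) (G : sgraph V) (a b : R) (t : seq R) :
  perm_eq (eigenvalues (adjmx R G)) ([:: a; b] ++ t) -> sorted >=%R t ->
  b <= a -> {in t, forall x, b <= x <= a} ->
  eigenvalues (adjmx R G) = a :: rcons t b.
Proof.
move=> perm_s st ba bt; have [_ sorted_s _] := graph_spectrum R V G.
apply: (sorted_eq ge_trans ge_anti sorted_s); first exact: sorted_ends.
by apply: (perm_trans perm_s); rewrite /= perm_cons perm_sym perm_rcons.
Qed.

(** * Distance of a bipartite graph to the complete one *)

(** This is [(|x| - 4)^2 >= 0]; the constant 4 is the absolute value of the
    non-extreme eigenvalues of the incidence graph of the design. *)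
Lemma norm_le_quadratic (R : rcfType) (x : R) : `|x| <= x ^+ 2 / 8%:R + 2%:R.
Proof.
rewrite -real_normK ?num_real //; have := sqr_ge0 (`|x| - 4%:R); move: (`|x|) => y.
rewrite sqrrB; lra.
Qed.

(** The middle eigenvalues contribute at most [(e - a^2 - b^2)/8 + 252], where
    [a] and [b] are the extreme ones.  What remains separates into a term in [a]
    and the same term in [-b], each at most 162 as long as [e <= 128 a]. *)
Lemma sigma_le_576 (R : rcfType) (V W : finType) (K : sgraph V) (H : sgraph W) :
  eigenvalues (adjmx R K) = 64%:R :: rcons (nseq 126 0) (- 64%:R) ->
  #|W| = 128%N -> bipartite_graph H -> sigma R K H <= 576%:R.
Proof.
move=> sK cardW /existsP[X bipX].
have [szH sortH] := graph_spectrum R W H.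
have [a [b [t [sH szt]]]] : exists a b t,
    eigenvalues (adjmx R H) = a :: rcons t b /\ size t = 126%N.
  by apply: seq_ends; rewrite szH cardW.
set e := \sum_x _ => sqH.
have cardWR : \sum_(x : W) (1 : R) = 128%:R by rewrite sumr_const cardW.
have e_le_a : e <= a * 128%:R.
  have := graph_rayleigh R W H (fun=> 1); rewrite sH /= => /andP[_].
  rewrite expr1n cardWR; apply: le_trans; rewrite le_eqVlt; apply/orP; left; apply/eqP.
  by apply: eq_bigr => x _; apply: eq_bigr => y _; rewrite !mul1r.
have b_le_e : b * 128%:R <= - e.
  have := graph_rayleigh R W H (fun x => (-1) ^+ (x \in X)); rewrite sH /= last_rcons => /andP[+ _].
  rewrite (eq_bigr (fun=> 1)) => [|x _]; last by rewrite sqrr_sign.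
  rewrite cardWR => /le_trans; apply; rewrite le_eqVlt; apply/orP; left; apply/eqP.
  rewrite /e -sumrN; apply: eq_bigr => x _; rewrite -sumrN; apply: eq_bigr => y _.
  have := forallP (forallP bipX x) y; case: (adj H x y) => /=; last by rewrite mulr0 oppr0.
  by case: (x \in X); case: (y \in X) => //= _; rewrite !expr0 !expr1 ?mulr1 ?mul1r.
rewrite (sigmaE _ _ _ _ _ _ _ _ _ _ _ sK sH) ?size_nseq //.
have -> : \sum_(p <- zip (nseq 126 (0 : R)) t) `|p.1 - p.2| = \sum_(x <- t) `|x|.
  rewrite -szt; elim: (t) => [|x u IHu]; rewrite ?big_nil // !big_cons /= IHu.
  by rewrite sub0r normrN.
have t_le : \sum_(x <- t) `|x| <= (e - a ^+ 2 - b ^+ 2) / 8%:R + 252%:R.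
  have -> : e = a ^+ 2 + (\sum_(x <- t) x ^+ 2 + b ^+ 2).
    by rewrite -sqH sH -cats1 big_cons big_cat big_seq1.
  apply: le_trans (ler_sum _ (fun x _ => norm_le_quadratic R x)) _.
  rewrite big_split /= -mulr_suml big_const_seq count_predT szt iter_addr_0 -mulr_natr.
  lra.
have sqa (x : R) : e <= x * 128%:R -> `|64%:R - x| + e / 16%:R - x ^+ 2 / 8%:R <= 162%:R.
  (* The parabola peaks at 28 for x <= 64, and at 36 (with a smaller value)
     once the absolute value changes sign. *)
  move=> ex; have := sqr_ge0 (x - 28%:R); have := sqr_ge0 (x - 36%:R).
  case: (ger0P (64%:R - x)) => _; nra.
have := sqa _ e_le_a; have := sqa (- b); rewrite mulNr lerNr => /(_ b_le_e).
rewrite -normrN opprD opprK sqrrN; lra.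
Qed.

(** * Isomorphic graphs *)

Lemma char_poly_reindex (F : fieldType) (m n : nat) (A : 'M[F]_m) (B : 'M[F]_n)
    (f : 'I_m -> 'I_n) :
  m = n -> injective f -> (forall i j, A i j = B (f i) (f j)) ->
  char_poly A = char_poly B.
Proof.
move=> eq_mn; case: n / eq_mn B f => B f f_inj AB.
case: m A B f f_inj AB => [|m] A B f f_inj AB; first by rewrite (flatmx0 A) (flatmx0 B).
pose s := perm f_inj.
have -> : A = invmx (perm_mx s^-1%g) *m B *m perm_mx s^-1%g.
  rewrite perm_mxV invmxK -perm_mxV -col_permE -row_permE.
  by apply/matrixP => i j; rewrite !mxE !permE AB.
by rewrite char_poly_conj // unitmx_perm.
Qed.

Lemma lambda_iso (R : rcfType) (V W : finType) (G : sgraph V) (H : sgraph W) (i : nat) :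
  graph_iso G H -> lambda R G i = lambda R H i.
Proof.
case/andP => /eqP eqVW /existsP[f /andP[/injectiveP f_inj /forallP adjf]].
rewrite /lambda /eigenvalues.
rewrite (char_poly_reindex _ _ _ _ (adjmx R H) (fun i => enum_rank (f (enum_val i))) eqVW) //.
  by move=> j k /enum_rank_inj/f_inj/enum_val_inj.
by move=> j k; rewrite !mxE !enum_rankK; have /forallP/(_ (enum_val k))/eqP -> := adjf (enum_val j).
Qed.

Lemma sigma_isol (R : rcfType) (V V' W : finType) (G : sgraph V) (G' : sgraph V')
    (H : sgraph W) :
  graph_iso G G' -> sigma R G H = sigma R G' H.
Proof.
move=> isoG; rewrite /sigma; have /andP[/eqP -> _] := isoG.
by apply: eq_bigr => i _; rewrite (lambda_iso R _ _ _ _ _ isoG).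
Qed.

Lemma sigma_isor (R : rcfType) (V W W' : finType) (G : sgraph V) (H : sgraph W)
    (H' : sgraph W') :
  graph_iso H H' -> sigma R G H = sigma R G H'.
Proof. by move=> isoH; apply: eq_bigr => i _; rewrite (lambda_iso R _ _ _ _ _ isoH). Qed.

Lemma sigma_iso_eq0 (R : rcfType) (V W : finType) (G : sgraph V) (H : sgraph W) :
  graph_iso H G -> sigma R G H = 0.
Proof.
by move=> isoHG; rewrite /sigma big1 // => i _; rewrite (lambda_iso R _ _ _ _ _ isoHG) subrr normr0.
Qed.

Lemma relabel_axiom (V : finType) (G : sgraph V) (n : nat) (g : 'I_n -> V) :
  simple_graph_axiom [ffun xy : 'I_n * 'I_n => adj G (g xy.1) (g xy.2)].
Proof.
apply/andP; split; apply/forallP => x; last first.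
  by apply/forallP => y; rewrite !ffunE /= adj_sym.
by rewrite ffunE /=; have /andP[/forallP/(_ (g x))] := edge_funP G.
Qed.

(** Moves a graph onto the standard vertex set, over which the eccentricity and
    the diameter are maximised. *)
Lemma relabel (V : finType) (G : sgraph V) (n : nat) :
  #|V| = n -> connected_graph G -> bipartite_graph G ->
  exists2 H, H \in conn_bipartite n & graph_iso H G.
Proof.
move=> cardV conG bipG; pose g (i : 'I_n) : V := enum_val (cast_ord (esym cardV) i).
pose h (x : V) : 'I_n := cast_ord cardV (enum_rank x).
have gK : cancel g h by move=> i; rewrite /h /g enum_valK cast_ordKV.
have hK : cancel h g by move=> x; rewrite /h /g cast_ordK enum_rankK.
pose H := SGraph (relabel_axiom _ G _ g).
have adjH i j : adj H i j = adj G (g i) (g j) by rewrite /adj /= ffunE.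
exists H; last first.
  rewrite /graph_iso card_ord cardV eqxx; apply/existsP; exists [ffun i => g i].
  apply/andP; split.
    by apply/injectiveP => i j; rewrite !ffunE => /(can_inj gK).
  by apply/forallP => i; apply/forallP => j; rewrite !ffunE adjH.
rewrite inE; apply/andP; split.
  apply/forallP => i; apply/forallP => j.
  rewrite -(gK i) -(gK j).
  have /connectP[p path_p ->] := forallP (forallP conG (g i)) (g j).
  elim: p (g i) path_p => [|y p IHp] x /=; first by rewrite connect0.
  case/andP => xy /IHp; apply: connect_trans; apply: connect1.
  by rewrite adjH !hK.
case/existsP: bipG => X /forallP bipX; apply/existsP; exists [set i | g i \in X].
by apply/forallP => i; apply/forallP => j; rewrite !inE adjH; exact: (forallP (bipX _)).
Qed.

(** * Bipartite graphs given by an incidence relation *)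

Lemma adj_bip (P Q : finType) (r : P -> Q -> bool) :
  (forall p p', adj (bip_graph r) (inl p) (inl p') = false) *
  (forall p q, adj (bip_graph r) (inl p) (inr q) = r p q) *
  (forall p q, adj (bip_graph r) (inr q) (inl p) = r p q) *
  (forall q q', adj (bip_graph r) (inr q) (inr q') = false).
Proof. by do !split=> *; rewrite /adj ffunE. Qed.

Lemma bip_bipartite (P Q : finType) (r : P -> Q -> bool) : bipartite_graph (bip_graph r).
Proof.
apply/existsP; exists [set x | if x is inl _ then true else false].
by apply/forallP => -[p|q]; apply/forallP => -[p'|q']; rewrite !inE adj_bip //= implybT.
Qed.

Lemma bip_connected (P Q : finType) (r : P -> Q -> bool) :
  (forall p p', exists q, r p q && r p' q) -> (forall q, exists p, r p q) ->
  connected_graph (bip_graph r).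
Proof.
move=> common nbr; set G := bip_graph r.
have symG : connect_sym (adj G) by apply: sym_connect_sym => x y; exact: adj_sym.
have conP p p' : connect (adj G) (inl p) (inl p').
  have [q /andP[pq p'q]] := common p p'.
  by apply: (connect_trans (y := inr q)); apply: connect1; rewrite adj_bip.
have to_P x : exists p, connect (adj G) x (inl p).
  case: x => [p|q]; first by exists p; apply: connect0.
  by have [p pq] := nbr q; exists p; apply: connect1; rewrite adj_bip.
apply/forallP => x; apply/forallP => y.
have [p xp] := to_P x; have [p' yp'] := to_P y.
by apply: connect_trans xp _; apply: connect_trans (conP p p') _; rewrite symG.
Qed.

Lemma bip_darts (R : rcfType) (P Q : finType) (r : P -> Q -> bool) :
  \sum_x \sum_y (adj (bip_graph r) x y)%:R = 2%:R * \sum_p \sum_q (r p q)%:R :> R.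
Proof.
rewrite big_sumType /= mulr_natl mulr2n; congr (_ + _).
  apply: eq_bigr => p _; rewrite big_sumType /= big1 ?add0r => [|p' _]; last by rewrite adj_bip.
  by apply: eq_bigr => q _; rewrite adj_bip.
rewrite [RHS]exchange_big /=; apply: eq_bigr => q _.
rewrite big_sumType /= addrC big1 ?add0r => [|q' _].
  by apply: eq_bigr => p _; rewrite adj_bip.
by rewrite adj_bip.
Qed.

Lemma bip_eigenvalueP (R : rcfType) (P Q : finType) (r : P -> Q -> bool) (a : R) :
  a \in eigenvalues (adjmx R (bip_graph r)) <->
  exists (u : P -> R) (w : Q -> R),
    [/\ (exists p, u p != 0) \/ (exists q, w q != 0),
        forall q, \sum_p u p * (r p q)%:R = a * w q
      & forall p, \sum_q w q * (r p q)%:R = a * u p].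
Proof.
have sum_inr (F : P + Q -> R) q :
    \sum_x F x * (adj (bip_graph r) x (inr q))%:R = \sum_p F (inl p) * (r p q)%:R.
  rewrite big_sumType /= addrC big1 ?add0r => [|q' _]; last by rewrite adj_bip mulr0.
  by apply: eq_bigr => p _; rewrite adj_bip.
have sum_inl (F : P + Q -> R) p :
    \sum_x F x * (adj (bip_graph r) x (inl p))%:R = \sum_q F (inr q) * (r p q)%:R.
  rewrite big_sumType /= big1 ?add0r => [|q' _]; last by rewrite adj_bip mulr0.
  by apply: eq_bigr => q _; rewrite adj_bip.
rewrite graph_eigenvalueP; split=> [[F [x Fx] FA]|[u [w [uw_neq0 eq_w eq_u]]]].
  exists (fun p => F (inl p)), (fun q => F (inr q)); split.
  - by case: x Fx => z Fz; [left|right]; exists z.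
  - by move=> q; rewrite -sum_inr FA.
  - by move=> p; rewrite -sum_inl FA.
exists (fun x => match x with inl p => u p | inr q => w q end).
  by case: uw_neq0 => -[z z_neq0]; [exists (inl z)|exists (inr z)].
by case=> z; rewrite ?sum_inl ?sum_inr.
Qed.

(** * The complete bipartite graph and [B_{128,43}] *)

Lemma spectrum_complete (R : rcfType) :
  eigenvalues (adjmx R (complete_bipartite 64 64)) = 64%:R :: rcons (nseq 126 0) (- 64%:R).
Proof.
set r := fun (_ : 'I_64) (_ : 'I_64) => true.
have sum64 (c : R) : \sum_(i < 64) c = c * 64%:R by rewrite sumr_const card_ord mulr_natr.
have mem_eig (a : R) : a ^+ 2 = 64%:R ^+ 2 -> a \in eigenvalues (adjmx R (bip_graph r)).
  move=> sqa; apply/bip_eigenvalueP; exists (fun=> a), (fun=> 64%:R); split.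
  - by right; exists ord0; rewrite pnatr_eq0.
  - by move=> q; rewrite /r sum64 mulr1.
  - by move=> q; rewrite /r sum64 mulr1 -expr2 -sqa expr2.
have cardV : #|{: 'I_64 + 'I_64}| = 128%N by rewrite card_sum !card_ord.
apply: spectrum_ends.
- rewrite (_ : nseq 126 0 = nseq (#|{: 'I_64 + 'I_64}| - size [:: 64%:R; - 64%:R : R])%N 0);
    last first.
    by rewrite cardV.
  apply: spectrum_extend0.
  + rewrite /= inE andbT; apply/eqP; lra.
  + by move=> x; rewrite !inE => /orP[]/eqP->; apply: mem_eig; rewrite ?sqrrN.
  + rewrite !big_cons big_nil bip_darts (eq_bigr (fun=> 64%:R)) => [|i _].
      by rewrite sum64; ring.
    by rewrite /r sum64 mul1r.
- by elim: (126%N) => // -[|k] //= ->; rewrite lexx.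
- lra.
- by move=> x /nseqP[-> _]; lra.
Qed.

Lemma sum_step43 (R : rcfType) (a b : R) :
  \sum_(i < 64) (if (i < 43)%N then a else b) = a * 43%:R + b * 21%:R.
Proof.
rewrite -(big_mkord xpredT (fun i => if (i < 43)%N then a else b)) (@big_cat_nat _ _ _ 43) //=.
congr (_ + _).
  rewrite (eq_big_nat _ _ (F2 := fun=> a)) => [|i /andP[_ ->] //].
  by rewrite big_const_nat iter_addr_0 mulr_natr.
rewrite (eq_big_nat _ _ (F2 := fun=> b)) => [|i /andP[le_i _]]; last by rewrite ltnNge le_i.
by rewrite big_const_nat iter_addr_0 mulr_natr.
Qed.

(** The eigenvector is constant on the four cells given by side and degree:
    on one side it takes the value [a] on the 43 vertices of full degree and
    [43 e] on the others, and on the other side [e] times the same values, [e]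
    being a sign. *)
Lemma mem_spectrum_B (R : rcfType) (a e : R) :
  e ^+ 2 = 1 -> a != 0 -> a ^+ 2 = e * 43%:R * a + 903%:R ->
  a \in eigenvalues (adjmx R (Bgraph 128 43)).
Proof.
move=> e2 a0 a2; pose u (i : 'I_64) : R := if (i < 43)%N then a else 43%:R * e.
have sum_u (j : 'I_64) : \sum_(i < 64) u i * ((i < 43)%N || (j < 43)%N)%:R = a * (e * u j).
  rewrite (eq_bigr (fun i : 'I_64 => if (i < 43)%N then a else
      if (j < 43)%N then 43%:R * e else 0)) => [|i _]; last first.
    by rewrite /u; case: (i < 43)%N; case: (j < 43)%N; rewrite /= ?mulr1 ?mulr0.
  rewrite sum_step43 /u; case: (j < 43)%N.
    transitivity (e ^+ 2 * (43%:R * a) + e * 903%:R); first by rewrite e2; ring.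
    by rewrite [RHS]mulrCA -expr2 a2; ring.
  by rewrite mul0r addr0 -[a in LHS]mul1r -e2; ring.
apply/bip_eigenvalueP; exists u, (fun j => e * u j); split.
- by left; exists ord0; rewrite /u.
- exact: sum_u.
- move=> i; rewrite (eq_bigr (fun j : 'I_64 => e * (u j * ((j < 43)%N || (i < 43)%N)%:R))).
    by rewrite -mulr_sumr sum_u -[a in RHS]mul1r -e2; ring.
  by move=> j _; rewrite orbC mulrA.
Qed.

(** Of the four roots of the two quadratics of [mem_spectrum_B], [b1] and [-b2]
    belong to the sign [+1], [b2] and [-b1] to the sign [-1].  The graph has
    [64^2 - 21^2 = 3655] edges, and [b1^2 + b2^2 = 43^2 + 2 * 903 = 3655], so
    every other eigenvalue vanishes. *)
Lemma spectrum_B (R : rcfType) (b1 b2 : R) :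
  0 < b2 -> b1 = b2 + 43%:R -> b1 * b2 = 903%:R ->
  eigenvalues (adjmx R (Bgraph 128 43)) =
    b1 :: rcons (b2 :: rcons (nseq 124 0) (- b2)) (- b1).
Proof.
move=> b2_gt0 b1E b12; set t := b2 :: _.
have b2sq : b2 ^+ 2 = 903%:R - 43%:R * b2 by rewrite -b12 b1E; ring.
have cardV : #|{: 'I_(128./2) + 'I_(128./2)}| = 128%N by rewrite card_sum !card_ord.
have t_perm : perm_eq t [:: b2, - b2 & nseq 124 0] by rewrite perm_cons perm_rcons.
apply: spectrum_ends.
- apply: (@perm_trans _ ([:: b1; - b1; b2; - b2] ++ nseq 124 0)); last first.
    by rewrite perm_sym -(perm_cat2l [:: b1; - b1]) in t_perm.
  rewrite (_ : nseq 124 0 =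
    nseq (#|{: 'I_(128./2) + 'I_(128./2)}| - size [:: b1; - b1; b2; - b2])%N 0); last first.
    by rewrite cardV.
  apply: spectrum_extend0.
  + rewrite /= !inE !negb_or !andbT.
    by repeat (apply/andP; split); apply/eqP; lra.
  + move=> x; rewrite !inE => /or4P[]/eqP->.
    * by apply: (mem_spectrum_B _ _ 1); [ring | apply/eqP; lra | rewrite b1E; nra].
    * by apply: (mem_spectrum_B _ _ (-1)); [ring | apply/eqP; lra | rewrite b1E; nra].
    * by apply: (mem_spectrum_B _ _ (-1)); [ring | apply/eqP; lra | nra].
    * by apply: (mem_spectrum_B _ _ 1); [ring | apply/eqP; lra | nra].
  + rewrite !big_cons big_nil bip_darts.
    rewrite (eq_bigr (fun i : 'I_64 => if (i < 43)%N then 64%:R else 43%:R)) => [|i _].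
      by rewrite sum_step43 !sqrrN b1E; nra.
    rewrite (eq_bigr (fun j : 'I_64 => if (j < 43)%N then 1 else if (i < 43)%N then 1 else 0)).
      by rewrite sum_step43; case: (i < 43)%N; ring.
    by move=> j _; case: (i < 43)%N; case: (j < 43)%N.
- apply: sorted_ends; [ | lra | ].
    by elim: (124%N) => // -[|k] //= ->; rewrite lexx.
  by move=> x /nseqP[-> _]; lra.
- lra.
- move=> x; rewrite (perm_mem t_perm) 2!in_cons => /or3P[/eqP->|/eqP->|/nseqP[-> _]]; lra.
Qed.

(** * Incidence graphs of (64,28,12) designs *)

Lemma sum_pred (R : rcfType) (T : finType) (f : pred T) :
  \sum_x (f x)%:R = #|[set x | f x]|%:R :> R.
Proof.
rewrite -sum1_card natr_sum [RHS]big_mkcond; apply: eq_bigr => x _.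
by rewrite inE; case: (f x).
Qed.

Lemma sum_blocks (R : rcfType) (P : finType) (D : {set {set P}}) (f : pred {set P}) :
  \sum_(B : {B : {set P} | B \in D}) (f (val B))%:R = #|[set B in D | f B]|%:R :> R.
Proof.
rewrite -(big_sub (mem D) (fun B => (f B)%:R)) -sum1_card natr_sum.
rewrite big_mkcond [RHS]big_mkcond; apply: eq_bigr => B _; rewrite inE.
by case: (B \in D); case: (f B).
Qed.

(** A square matrix with trivial left kernel has trivial right kernel; stated for
    matrices indexed by two finite types of the same cardinal. *)
Lemma square_injective_tr (R : fieldType) (P Q : finType) (M : P -> Q -> R) :
  #|P| = #|Q| ->
  (forall u : P -> R, (forall q, \sum_p u p * M p q = 0) -> forall p, u p = 0) ->
  forall w : Q -> R, (forall p, \sum_q w q * M p q = 0) -> forall q, w q = 0.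
Proof.
move=> eqPQ inj w w0 q.
pose N := \matrix_(i < #|P|, j < #|Q|) M (enum_val i) (enum_val j).
have freeN : row_free N.
  apply: inj_row_free => v /rowP vN0; apply/rowP => i; rewrite mxE.
  rewrite -[i in LHS]enum_valK; apply: (inj (fun p => v 0 (enum_rank p))) => {}q.
  have := vN0 (enum_rank q); rewrite !mxE; apply: etrans.
  rewrite [RHS](reindex _ (onW_bij _ (enum_rank_bij P))).
  by apply: eq_bigr => p _; rewrite mxE !enum_rankK.
have freeNT : row_free N^T by rewrite /row_free mxrank_tr (eqP freeN) eqPQ.
have /rowP row_w0 : \row_j w (enum_val j) = 0 :> 'rV_#|Q|.
  apply: (row_free_inj freeNT); rewrite mul0mx; apply/rowP => i; rewrite !mxE.
  apply: etrans (w0 (enum_val i)); rewrite [RHS](reindex _ (onW_bij _ (enum_val_bij Q))).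
  by apply: eq_bigr => j _; rewrite !mxE.
by have := row_w0 (enum_rank q); rewrite !mxE enum_rankK.
Qed.

(** The identity [N N^T = 16 I + 12 J], applied to the vector [u]. *)
Lemma design_gram (R : rcfType) (P : finType) (D : {set {set P}}) (u : P -> R) (p : P) :
  symmetric_design 64 28 12 D ->
  \sum_(B : {B : {set P} | B \in D}) (\sum_q u q * (q \in val B)%:R) * (p \in val B)%:R =
    16%:R * u p + 12%:R * \sum_q u q.
Proof.
case=> _ _ _ deg1 deg2.
transitivity (\sum_q u q * \sum_(B : {B : {set P} | B \in D}) ((q \in val B) && (p \in val B))%:R).
  under eq_bigr do rewrite mulr_suml.
  rewrite exchange_big; apply: eq_bigr => q _; rewrite mulr_sumr; apply: eq_bigr => B _.
  by rewrite -mulnb natrM mulrA.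
rewrite mulr_sumr (bigD1 p) //= [in RHS](bigD1 p) //= addrA; congr (_ + _).
  rewrite (sum_blocks R P D (fun B : {set P} => (p \in B) && (p \in B))).
  under eq_finset do rewrite andbb.
  by rewrite deg1; ring.
apply: eq_bigr => q qp.
rewrite (sum_blocks R P D (fun B : {set P} => (q \in B) && (p \in B))) deg2 //.
by rewrite mulrC.
Qed.

Lemma card_blocks (P : finType) (D : {set {set P}}) : #|{: {B : {set P} | B \in D}}| = #|D|.
Proof. by rewrite card_sig; apply: eq_card => B; rewrite inE. Qed.

(** Eigenvalues of [16 I + 12 J]: summing the equations gives 784 unless the
    entries of [u] add up to 0, in which case only 16 is possible. *)
Lemma design_eigen (R : rcfType) (P : finType) (D : {set {set P}}) (u : P -> R) (c : R) :
  symmetric_design 64 28 12 D ->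
  (forall p, c * u p = 16%:R * u p + 12%:R * \sum_q u q) ->
  [\/ c = 16%:R, c = 784%:R | forall p, u p = 0].
Proof.
move=> designD u_eq; have [cardP _ _ _ _] := designD.
have [U0|U0] := eqVneq (\sum_q u q) 0.
  case: (pickP (fun p => u p != 0)) => [p up|u0]; last first.
    by constructor 3 => p; have /negbFE/eqP := u0 p.
  constructor 1; apply: (mulIf up); rewrite u_eq U0; ring.
constructor 2; apply: (mulIf U0); rewrite mulr_sumr (eq_bigr _ (fun p _ => u_eq p)).
by rewrite big_split /= sumr_const cardP -mulr_sumr -[_ *+ _]mulr_natr; ring.
Qed.

(** By [design_eigen], 0 is not an eigenvalue of [N N^T], so [N] is invertible.
    This excludes an eigenvector of the incidence graph supported on the
    blocks. *)
Lemma design_incidence_inj (R : rcfType) (P : finType) (D : {set {set P}}) :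
  symmetric_design 64 28 12 D ->
  forall w : {B : {set P} | B \in D} -> R,
  (forall p, \sum_B w B * (p \in val B)%:R = 0) -> forall B, w B = 0.
Proof.
move=> designD; have [cardP cardD _ _ _] := designD.
apply: square_injective_tr; first by rewrite card_blocks cardP cardD.
move=> u u0; have := design_eigen R P D u 0 designD.
case=> [p|/eqP|/eqP|//]; rewrite ?[0 == _]eq_sym ?pnatr_eq0 //.
rewrite -(design_gram _ _ _ _ _ designD) mul0r big1 // => B _.
by rewrite u0 mul0r.
Qed.

(** The signs of the middle eigenvalues are left undetermined: the distance to
    [K] depends on their absolute values alone, and so does the lower bound used
    for the distance to [B_{128,43}]. *)
Lemma spectrum_design (R : rcfType) (P : finType) (D : {set {set P}}) :
  symmetric_design 64 28 12 D ->
  exists t, [/\ size t = 126%N, {in t, forall x, x ^+ 2 = 16%:R}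
    & eigenvalues (adjmx R (incidence_graph D)) = 28%:R :: rcons t (- 28%:R)].
Proof.
move=> designD; have [cardP cardD szB deg1 _] := designD.
set s := eigenvalues _.
have s_mem a : a ^+ 2 = 28%:R ^+ 2 -> a \in s.
  move=> sqa; have /card_gt0P[p0 _] : (0 < #|P|)%N by rewrite cardP.
  apply/bip_eigenvalueP; exists (fun=> a), (fun=> 28%:R); split.
  - left; exists p0; rewrite -sqrf_eq0 sqa sqrf_eq0 pnatr_eq0 //.
  - move=> B; rewrite -mulr_sumr sum_pred.
    by rewrite (_ : [set x | x \in val B] = val B) ?szB ?(valP B) //; apply/setP => x; rewrite inE.
  - move=> p; rewrite -mulr_sumr (sum_blocks R P D (fun B : {set P} => p \in B)) deg1.
    by rewrite -expr2 -sqa expr2.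
have s_sq a : a \in s -> a ^+ 2 = 16%:R \/ a ^+ 2 = 784%:R.
  case/bip_eigenvalueP => u [w [uw0 w_eq u_eq]].
  have [p|||u0] := design_eigen R P D u (a ^+ 2) designD; [|by left|by right|].
    rewrite -(design_gram _ _ _ _ _ designD) expr2 -mulrA -u_eq mulr_sumr.
    by apply: eq_bigr => B _; rewrite w_eq mulrA.
  have w0 : forall B, w B = 0.
    by apply: (design_incidence_inj _ _ _ designD) => p; rewrite u_eq u0 mulr0.
  by case: uw0 => -[z]; rewrite ?u0 ?w0 eqxx.
have cardV : #|{: P + {B : {set P} | B \in D}}| = 128%N.
  by rewrite card_sum card_blocks cardP cardD.
have [||||t perm_t t_sq] := spectrum_extend R _ (incidence_graph D) [:: 28%:R; - 28%:R] 16%:R.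
- rewrite /= inE andbT; apply/eqP; lra.
- by move=> x; rewrite !inE => /orP[]/eqP->; apply: s_mem; rewrite ?sqrrN.
- by move=> x /s_sq[]->; lra.
- rewrite !big_cons big_nil bip_darts cardV (_ : (128 - _)%N = 126%N) //.
  rewrite (eq_bigr (fun=> 28%:R)) => [|p _]; last first.
    by rewrite (sum_blocks R P D (fun B : {set P} => p \in B)) deg1.
  by rewrite sumr_const cardP -mulr_natr; ring.
have szt : size t = 126%N.
  have [szs _ _] := graph_spectrum R _ (incidence_graph D).
  by have := perm_size perm_t; rewrite szs cardV => -[].
have sort_t : perm_eq (sort >=%R t) t by apply/permPl/perm_sort.
exists (sort >=%R t); split; first by rewrite size_sort.
  by move=> x; rewrite mem_sort => /t_sq.
apply: spectrum_ends.
- by apply: (perm_trans perm_t); rewrite perm_cat2l perm_sym.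
- exact/sort_sorted/ge_total.
- lra.
- move=> x; rewrite mem_sort => /t_sq sqx.
  by rewrite -ler_norml -(ler_pXn2r (ltn0Sn 1)) ?nnegrE // real_normK ?num_real // sqx; lra.
Qed.

(** * Existence of a (64,28,12) design *)

(** Points and blocks are both the words of length 3 over 4 letters, incident
    when they agree in an odd number of positions.  The sign matrix
    [(-1) ^+ agree_odd x y] is the third tensor power of the 4 by 4 matrix with
    [-1] on the diagonal and [1] elsewhere, a regular Hadamard matrix; tensor
    powers of such matrices are again regular Hadamard matrices, whose entries
    [-1] are the incidences of a Menon design. *)
Definition agree_odd (x y : {ffun 'I_3 -> 'I_4}) : bool :=
  odd (\sum_k (x k == y k)).

Lemma agree_odd_sym x y : agree_odd x y = agree_odd y x.
Proof. by congr odd; apply: eq_bigr => k _; rewrite eq_sym. Qed.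

Lemma sign_agree (x y : {ffun 'I_3 -> 'I_4}) :
  (-1) ^+ agree_odd x y = \prod_k (-1) ^+ (x k == y k) :> int.
Proof. by rewrite signr_odd expr_sum. Qed.

Lemma sum_eq1 (a : 'I_4) : \sum_c (a == c)%:R = 1 :> int.
Proof. by rewrite (bigD1 a) //= eqxx big1 ?addr0 // => c; rewrite eq_sym => /negPf ->. Qed.

Lemma sum_sign1 (a : 'I_4) : \sum_c (-1) ^+ (a == c) = 2%:R :> int.
Proof.
under eq_bigr do rewrite signrE -muln2 natrM.
by rewrite sumrB -mulr_suml sum_eq1 sumr_const card_ord.
Qed.

Lemma sum_sign2 (a b : 'I_4) : a != b ->
  \sum_c (-1) ^+ (a == c) * (-1) ^+ (b == c) = 0 :> int.
Proof.
move=> ab.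
rewrite (eq_bigr (fun c => 1 - 2%:R * (a == c)%:R - 2%:R * (b == c)%:R)) => [|c _].
  by rewrite !sumrB -!mulr_sumr !sum_eq1 sumr_const card_ord.
case: (eqVneq a c) ab => [-> /negPf|_ _]; first by rewrite eq_sym => ->.
by case: (b == c).
Qed.

Lemma sum_sign_agree (x : {ffun 'I_3 -> 'I_4}) :
  \sum_y (-1) ^+ agree_odd x y = 8%:R :> int.
Proof.
under eq_bigr do rewrite sign_agree.
rewrite -(bigA_distr_bigA (fun k c => (-1) ^+ (x k == c))).
by under eq_bigr do rewrite sum_sign1; rewrite prodr_const card_ord.
Qed.

Lemma sum_sign_agree2 (x x' : {ffun 'I_3 -> 'I_4}) : x != x' ->
  \sum_y (-1) ^+ agree_odd x y * (-1) ^+ agree_odd x' y = 0 :> int.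
Proof.
move=> xx'; have [k xk] : exists k, x k != x' k.
  apply/existsP; apply: contraNT xx'; rewrite negb_exists => /forallP xx'.
  by apply/eqP/ffunP => k; apply/eqP; have := xx' k; rewrite negbK.
under eq_bigr do rewrite !sign_agree -big_split /=.
rewrite -(bigA_distr_bigA (fun k c => (-1) ^+ (x k == c) * (-1) ^+ (x' k == c))).
by rewrite (bigD1 k) //= sum_sign2 // mul0r.
Qed.

Lemma card_words : #|{: {ffun 'I_3 -> 'I_4}}| = 64%N.
Proof. by rewrite card_ffun !card_ord. Qed.

(** Incidence is [(1 - sign)/2], and the signs of a row add up to 8. *)
Lemma card_agree (x : {ffun 'I_3 -> 'I_4}) : #|[set y | agree_odd x y]| = 28%N.
Proof.
have : (#|[set y | agree_odd x y]|%:R *+ 2 = 56%:R :> int).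
  rewrite -(_ : \sum_y (1 - (-1) ^+ agree_odd x y) = 56%:R).
    rewrite -sum1_card natr_sum big_mkcond -sumrMnl; apply: eq_bigr => y _.
    by rewrite inE signrE; case: (agree_odd x y).
  by rewrite sumrB sum_sign_agree sumr_const card_words.
by move/eqP; rewrite -mulrnA eqr_nat => /eqP; lia.
Qed.

(** Expanding [(1 - sign) (1 - sign')] over two distinct rows leaves
    [64 - 8 - 8 + 0 = 48], since the rows are orthogonal. *)
Lemma card_agree2 (x x' : {ffun 'I_3 -> 'I_4}) : x != x' ->
  #|[set y | agree_odd x y && agree_odd x' y]| = 12%N.
Proof.
move=> xx'; have : (#|[set y | agree_odd x y && agree_odd x' y]|%:R *+ 4 = 48%:R :> int).
  rewrite -(_ : \sum_y (1 - (-1) ^+ agree_odd x y - (-1) ^+ agree_odd x' y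
                        + (-1) ^+ agree_odd x y * (-1) ^+ agree_odd x' y) = 48%:R).
    rewrite -sum1_card natr_sum big_mkcond -sumrMnl; apply: eq_bigr => y _.
    by rewrite inE !signrE; case: (agree_odd x y); case: (agree_odd x' y).
  by rewrite big_split !sumrB /= sum_sign_agree2 // !sum_sign_agree sumr_const card_words.
by move/eqP; rewrite -mulrnA eqr_nat => /eqP; lia.
Qed.

Lemma card_filter_imset (I T : finType) (g : I -> T) (f : pred T) : injective g ->
  #|[set B in [set g i | i : I] | f B]| = #|[set i | f (g i)]|.
Proof.
move=> g_inj; rewrite -(card_imset _ g_inj); apply: eq_card => B; rewrite inE.
apply/andP/imsetP => [[/imsetP[j _ ->] fj]|[j]]; first by exists j; rewrite ?inE.
by rewrite inE => fj ->; rewrite imset_f ?inE.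
Qed.

(** Distinct words give distinct blocks because two equal blocks would meet in 28
    points instead of 12. *)
Lemma menon_design : symmetric_design 64 28 12
  [set [set x | agree_odd x y] | y : {ffun 'I_3 -> 'I_4}].
Proof.
pose blk (y : {ffun 'I_3 -> 'I_4}) := [set x | agree_odd x y].
have card_blk y : #|blk y| = 28%N.
  by rewrite -(card_agree y); apply: eq_card => x; rewrite !inE agree_odd_sym.
have blk_inj : injective blk.
  move=> y y' eq_blk; apply/eqP/negP => /negP yy'.
  have := card_agree2 _ _ yy'.
  rewrite (_ : [set x | _] = blk y); first by rewrite card_blk.
  apply/setP => x; have /setP/(_ x) := eq_blk; rewrite !inE !(agree_odd_sym x) => <-.
  by rewrite andbb.
split; first exact: card_words.
- by rewrite card_imset // card_words.
- by move=> B /imsetP[y _ ->]; exact: card_blk.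
- move=> x; rewrite card_filter_imset // -(card_agree x).
  by apply: eq_card => y; rewrite !inE.
- move=> x y xy; rewrite card_filter_imset // -(card_agree2 _ _ xy).
  by apply: eq_card => z; rewrite !inE.
Qed.

(** * The three spectral distances *)

Lemma sqr16_norm (R : rcfType) (x : R) : x ^+ 2 = 16%:R -> `|x| = 4%:R.
Proof.
move=> sqx; apply/eqP; rewrite -(eqrXn2 (n := 2)) ?normr_ge0 ?ler0n //.
by rewrite real_normK ?num_real // sqx -natrX.
Qed.

Lemma sigma_complete_design (R : rcfType) (P : finType) (D : {set {set P}}) :
  symmetric_design 64 28 12 D ->
  sigma R (complete_bipartite 64 64) (incidence_graph D) = 576%:R.
Proof.
case/(spectrum_design R) => t [szt t_sq specD].
rewrite (sigmaE _ _ _ _ _ _ _ _ _ _ _ (spectrum_complete R) specD) ?size_nseq //.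
rewrite (_ : \sum_(p <- _) _ = 4%:R * 126%:R); last first.
  rewrite -szt; elim: t t_sq {szt specD} => [|x t IHt] t_sq; first by rewrite big_nil mulr0.
  rewrite big_cons /= IHt => [|y yt]; last by rewrite t_sq ?in_cons ?yt ?orbT.
  by rewrite sub0r normrN (sqr16_norm _ _ (t_sq _ (mem_head _ _))) -natr1; ring.
rewrite ger0_norm; last lra.
rewrite ler0_norm; lra.
Qed.

(** The first, second, second-to-last and last positions are estimated
    separately; everywhere else an eigenvalue of absolute value 4 faces a 0. *)
Lemma sigma_design_B (R : rcfType) (P : finType) (D : {set {set P}}) :
  symmetric_design 64 28 12 D ->
  576%:R < sigma R (incidence_graph D) (Bgraph 128 43).
Proof.
case/(spectrum_design R) => t [szt t_sq specD].
pose s : R := Num.sqrt 5461%:R.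
have s_sq : s ^+ 2 = 5461%:R by rewrite sqr_sqrtr ?ler0n.
have s_gt : 72%:R < s.
  by rewrite -(ltr_pXn2r (ltn0Sn 1)) ?nnegrE ?ler0n ?sqrtr_ge0 // s_sq -natrX ltr_nat.
pose b1 := (s + 43%:R) / 2%:R; pose b2 := (s - 43%:R) / 2%:R.
have specB : eigenvalues (adjmx R (Bgraph 128 43)) =
    b1 :: rcons (b2 :: rcons (nseq 124 0) (- b2)) (- b1).
  apply: spectrum_B; rewrite /b1 /b2; [lra | lra | nra].
have [x [y [u [t_def szu]]]] := seq_ends _ t 124 szt.
have t_norm z : z \in t -> `|z| = 4%:R by move/t_sq/sqr16_norm.
rewrite (sigmaE _ _ _ _ _ _ _ _ _ _ _ specD specB); last by rewrite szt.
have -> : zip t (b2 :: rcons (nseq 124 0) (- b2)) =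
    (x, b2) :: rcons (zip u (nseq 124 0)) (y, - b2).
  by rewrite t_def -zip_rcons ?szu ?size_nseq.
rewrite -cats1 big_cons big_cat big_seq1.
have -> : \sum_(p <- zip u (nseq 124 0)) `|p.1 - p.2| = 4%:R * 124%:R.
  have u_norm z : z \in u -> `|z| = 4%:R.
    by move=> zu; apply: t_norm; rewrite t_def in_cons mem_rcons in_cons zu !orbT.
  rewrite -szu; elim: u u_norm {szu t_def} => [|z u IHu] u_norm; first by rewrite big_nil mulr0.
  rewrite big_cons /= IHu => [|z' zu]; last by rewrite u_norm ?in_cons ?zu ?orbT.
  by rewrite subr0 u_norm ?mem_head // -natr1; ring.
have x4 : `|x| = 4%:R by apply: t_norm; rewrite t_def mem_head.
have y4 : `|y| = 4%:R by apply: t_norm; rewrite t_def in_cons mem_rcons mem_head orbT.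
have dist_first : b1 - 28%:R <= `|28%:R - b1| by rewrite distrC ler_norm.
have dist_last : b1 - 28%:R <= `|- 28%:R - - b1| by apply: le_trans (ler_norm _); lra.
have dist_x : b2 - 4%:R <= `|x - b2|.
  by rewrite distrC; have := lerB_dist b2 x; have := ler_norm b2; lra.
have dist_y : b2 - 4%:R <= `|y - - b2|.
  by rewrite distrC; have := lerB_dist (- b2) y; have := ler_norm b2; rewrite normrN; lra.
move: dist_first dist_last dist_x dist_y; rewrite /b1 /b2 /=; lra.
Qed.

Lemma incidence_connected (P : finType) (D : {set {set P}}) :
  symmetric_design 64 28 12 D -> connected_graph (incidence_graph D).
Proof.
case=> cardP _ szB deg1 deg2; apply: bip_connected => [p p'|[B DB]]; last first.
  have /card_gt0P[p pB] : (0 < #|B|)%N by rewrite szB.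
  by exists p.
have : (0 < #|[set B in D | (p \in B) && (p' \in B)]|)%N.
  have [->|pp'] := eqVneq p p'; last by rewrite deg2.
  by under eq_finset do rewrite andbb; rewrite deg1.
case/card_gt0P => B; rewrite inE => /andP[DB ppB].
by exists (exist _ B DB).
Qed.

Lemma Bgraph_connected : connected_graph (Bgraph 128 43).
Proof.
apply: bip_connected => [p p'|q]; first by exists ord0; rewrite !orbT.
by exists ord0.
Qed.

Theorem mainTheorem3 (R : rcfType) :
  (exists (P : finType) (D : {set {set P}}), symmetric_design 64 28 12 D) /\
  (forall (P : finType) (D : {set {set P}}),
     symmetric_design 64 28 12 D ->
     [/\ secc R (conn_bipartite 128) (complete_bipartite 64 64)
           = sigma R (complete_bipartite 64 64) (incidence_graph D),
         sigma R (complete_bipartite 64 64) (incidence_graph D)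
           < sigma R (incidence_graph D) (Bgraph 128 43),
         sdiam R (conn_bipartite 128)
           <> secc R (conn_bipartite 128) (complete_bipartite 64 64)
       & ~ sdiam_conjecture R 128]).
Proof.
split; first by do 2 eexists; exact: menon_design.
move=> P D designD; have [cardP cardD _ _ _] := designD.
have sKD := sigma_complete_design R P D designD.
have sDB := sigma_design_B R P D designD.
have card_D : #|{: P + {B : {set P} | B \in D}}| = 128%N.
  by rewrite card_sum card_blocks cardP cardD.
have card_B : #|{: 'I_(128./2) + 'I_(128./2)}| = 128%N by rewrite card_sum !card_ord.
have [GD FD isoD] := relabel _ _ _ card_D (incidence_connected P D designD) (bip_bipartite _ _ _).
have [GB FB isoB] := relabel _ _ _ card_B Bgraph_connected (bip_bipartite _ _ _).
have seccK : secc R (conn_bipartite 128) (complete_bipartite 64 64) = 576%:R.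
  apply/eqP; rewrite eq_le; apply/andP; split.
    apply: bigmax_le => [|H /andP[]]; first by rewrite ler0n.
    rewrite inE => /andP[_ bipH] _.
    by apply: sigma_le_576; rewrite ?card_ord // spectrum_complete.
  rewrite -sKD -(sigma_isor R _ _ _ _ _ _ isoD); apply: le_bigmax_cond.
  rewrite FD /=; apply/negP => /(sigma_iso_eq0 R)/eqP.
  by rewrite (sigma_isor R _ _ _ _ _ _ isoD) sKD pnatr_eq0.
have sGDB : 576%:R < sigma R GD GB.
  by rewrite (sigma_isol R _ _ _ _ _ _ isoD) (sigma_isor R _ _ _ _ _ _ isoB).
have sdiam_gt : 576%:R < sdiam R (conn_bipartite 128).
  apply: (lt_le_trans sGDB).
  apply: (@le_trans _ _ (secc R (conn_bipartite 128) GD)).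
    apply: le_bigmax_cond; rewrite FB /=; apply/negP => /(sigma_iso_eq0 R) eq0.
    by move: sGDB; rewrite eq0 ltrn0.
  exact: (le_bigmax_cond _ (fun G => secc R (conn_bipartite 128) G) FD).
have neq : sdiam R (conn_bipartite 128)
    <> secc R (conn_bipartite 128) (complete_bipartite 64 64).
  by rewrite seccK => eq576; rewrite eq576 ltxx in sdiam_gt.
by split=> //; [rewrite seccK sKD | rewrite sKD].
Qed.
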